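(* Let $m\ge 3$. Suppose $\theta_1,\theta_2$ are convex, $\theta_i$ is strongly convex with modulus $\mu_i>0$ for $i=3,\dots,m$, every $A_i$ ($i=1,\dots,m$) has full column rank, and there exists $u'=(x_1',\dots,x_m')\in ri(dom(\theta_1)\times\cdots\times dom(\theta_m))\cap\mathcal F$. Let $\{w^k\}$ be generated by the e-ADMM with $$\beta\in\left(0,\ \min_{3\le i\le m}\frac{\mu_i}{\left(\frac{13+\sqrt{33}}{4}m-\frac{17+\sqrt{33}}{2}\right)\|A_i^\top A_i\|}\right).$$ For $t\ge1$ put $x_{i,t}:=\frac1t\sum_{k=1}^tx_i^{k+1}$ ($i=1,\dots,m$), $u_t:=\frac1t\sum_{k=1}^tu^{k+1}$ and $w_t:=\frac1t\sum_{k=1}^tw^{k+1}$. Let $\kappa$ be a constant such that $\|A_ix_i^k\|\le\kappa$ for $i=1,\dots,m$ and $\|z^k\|\le\kappa$ for all $k\ge0$ (for $i=1$ only $k\ge 1$ is considered); such a constant exists. Then: 1) With $\bar C:=\beta\sum_{i=3}^m\tau_i\|A_ix_i^1-A_ix_i^0\|^2$, where $\tau_i:=\frac{i-3}{2}+\frac{(7+\sqrt{33})(m-2)}{8}$, for all $w\in\mathcal W$ and all $t\ge 1$, $$\theta(u_t)-\theta(u)+(w_t-w)^\top F(w)\le\frac1t\left[2\beta\kappa(m-1)\Big\|\sum_{i=1}^mA_ix_i-b\Big\|+\frac12\|v^1-v\|_Q^2+\bar C\right].$$ 2) There exists a constant $\bar c_1>0$, independent of $t$, such that $\left\|\sum_{i=1}^mA_ix_{i,t}-b\right\|^2\le\frac{\bar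 c_1}{t^2}$ for all $t\ge1$. 3) There exists a constant $\bar c_2>0$, independent of $t$, such that $|\theta(u_t)-\theta(u^* )|\le\frac{\bar c_2}{t}$ for all $t\ge1$, where $u^*=(x_1^*,\dots,x_m^* )$ with $w^*=(u^*,z^* )\in\mathcal W^*$.
   Context: Problem (P): minimize $\sum_{i=1}^m\theta_i(x_i)$ subject to $\sum_{i=1}^m A_ix_i=b$, $x_i\in\mathcal X_i$ ($i=1,\dots,m$), where $\theta_i:\mathbb R^{n_i}\to\mathbb R$ are closed proper convex functions (not necessarily smooth), $A_i\in\mathbb R^{l\times n_i}$, $\mathcal X_i\subseteq\mathbb R^{n_i}$ are nonempty closed convex sets, and $b\in\mathbb R^l$. The solution set of (P) is assumed nonempty. $\mathcal F=\{(x_1,\dots,x_m)\in\mathcal X_1\times\cdots\times\mathcal X_m:\sum_iA_ix_i=b\}$; $dom$ denotes the domain and $ri$ the set of relative interior points. A function $f$ is strongly convex with modulus $\mu>0$ if $f(tx+(1-t)y)\le tf(x)+(1-t)f(y)-\frac{\mu}{2}t(1-t)\|x-y\|^2$ for all $x,y$ and $t\in[0,1]$. For a matrix, $\|\cdot\|$ is the spectral (2-)norm; $\|x\|_M^2=x^\top Mx$ for $M$ symmetric positive semidefinite. Augmented Lagrangian ($\beta>0$): $\mathcal L_\beta(x_1,\dots,x_m,z)=\sum_i\theta_i(x_i)-z^\top(\sum_iA_ix_i-b)+\frac{\beta}{2}\|\sum_iA_ix_i-b\|^2$, $z\in\mathbb R^l$. e-ADMM: from an arbitrary initial $(x_2^0,\dots,x_m^0,z^0)$,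 for $k=0,1,2,\dots$ compute successively for $i=1,\dots,m$ $x_i^{k+1}=\arg\min\{\mathcal L_\beta(x_1^{k+1},\dots,x_{i-1}^{k+1},x_i,x_{i+1}^k,\dots,x_m^k,z^k): x_i\in\mathcal X_i\}$, and then $z^{k+1}=z^k-\beta(\sum_{i=1}^mA_ix_i^{k+1}-b)$. Notation: $u=(x_1,\dots,x_m)$, $v=(x_2,\dots,x_m,z)$, $w=(x_1,\dots,x_m,z)$ (same with superscripts); $\theta(u)=\sum_i\theta_i(x_i)$; $F(w)=(-A_1^\top z,\dots,-A_m^\top z,\ \sum_iA_ix_i-b)$; $Q=\mathrm{diag}(\beta A_2^\top A_2,\dots,\beta A_m^\top A_m,\frac1\beta I)$ (block diagonal); $\mathcal W=\mathcal X_1\times\cdots\times\mathcal X_m\times\mathbb R^l$. $\mathcal W^*$ is the set of saddle points in $\mathcal W$ of the Lagrangian $\mathcal L(x_1,\dots,x_m,z)=\sum_i\theta_i(x_i)-z^\top(\sum_iA_ix_i-b)$ (minimized over $x_i\in\mathcal X_i$, maximized over $z\in\mathbb R^l$). Standing assumption: $\mathcal W^*\ne\emptyset$. *)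

(* Defs.v *)
From mathcomp Require Export all_boot all_order all_algebra.
From mathcomp Require Export all_classical all_reals all_analysis.
Export numFieldNormedType.Exports.

Set Implicit Arguments.
Unset Strict Implicit.
Unset Printing Implicit Defensive.

Import Order.TTheory GRing.Theory Num.Theory.

Local Open Scope classical_set_scope.
Local Open Scope ring_scope.

(* The library norm on matrices is the sup norm, hence a separate Euclidean
   norm. *)
Definition dotp (R : realType) (N : nat) (x y : 'cV[R]_N) : R :=
  (x^T *m y) 0 0.

Definition enorm (R : realType) (N : nat) (x : 'cV[R]_N) : R :=
  Num.sqrt (dotp x x).

Definition spectral_norm (R : realType) (p q : nat) (M : 'M[R]_(p, q)) : R :=
  sup [set enorm (M *m x) | x in [set x : 'cV[R]_q | enorm x <= 1]].

(* ||x||_M^2 *)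
Definition qnorm2 (R : realType) (N : nat) (M : 'M[R]_N) (x : 'cV[R]_N) : R :=
  dotp x (M *m x).

(* Convex functions take values in \bar R; the domain is where they are
   finite, -oo being excluded by properness. *)
Definition edom (R : realType) (N : nat) (f : 'cV[R]_N -> \bar R) :
    set 'cV[R]_N :=
  [set x | (f x < +oo)%E].

Definition proper (R : realType) (N : nat) (f : 'cV[R]_N -> \bar R) : Prop :=
  edom f !=set0 /\ forall x, (-oo < f x)%E.

Definition convex (R : realType) (N : nat) (f : 'cV[R]_N -> \bar R) : Prop :=
  forall (x y : 'cV[R]_N) (t : R), 0 <= t <= 1 ->
    (f (t *: x + (1 - t) *: y)%R <= t%:E * f x + (1 - t)%:E * f y)%E.

Definition strongly_convex (R : realType) (N : nat) (mu : R)
    (f : 'cV[R]_N -> \bar R) : Prop :=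
  forall (x y : 'cV[R]_N) (t : R), 0 <= t <= 1 ->
    (f (t *: x + (1 - t) *: y)%R <=
       t%:E * f x + (1 - t)%:E * f y
       - (mu / 2 * t * (1 - t) * enorm (x - y) ^+ 2)%:E)%E.

(* For a proper function, closed (i.e. with closed epigraph) means lower
   semicontinuous. *)
Definition closed_proper_convex (R : realType) (N : nat)
    (f : 'cV[R]_N -> \bar R) : Prop :=
  [/\ lower_semicontinuous f, proper f & convex f].

Definition aff (R : realType) (N : nat) (C : set 'cV[R]_N) : set 'cV[R]_N :=
  [set y | exists (k : nat) (c : 'I_k -> R) (p : 'I_k -> 'cV[R]_N),
     [/\ forall j, C (p j), \sum_(j < k) c j = 1 &
         y = \sum_(j < k) c j *: p j]].

(* Interior relative to the affine hull. *)
Definition ri (R : realType) (N : nat) (C : set 'cV[R]_N) : set 'cV[R]_N :=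
  [set x | C x /\ within (aff C) (nbhs x) C].

(* Set of minimizers, with the usual convention in extended-valued
   optimization that it is empty when f is identically +oo on C. *)
Definition argmin (R : realType) (T : Type) (f : T -> \bar R) (C : set T) :
    set T :=
  [set x | [/\ C x, (f x < +oo)%E & forall y, C y -> (f x <= f y)%E]].

(* u = (x_1, ..., x_m) and w = (x_1, ..., x_m, z). Blocks are numbered from 0:
   the i-th block (counting from 1) has index i - 1 in 'I_m. *)
Definition blocks (R : realType) (m : nat) (n : 'I_m -> nat) : Type :=
  forall i : 'I_m, 'cV[R]_(n i).

Definition point (R : realType) (m l : nat) (n : 'I_m -> nat) : Type :=
  (blocks R n * 'cV[R]_l)%type.

Section problem.
Context (R : realType) (m l : nat) (n : 'I_m -> nat).
Variables (theta : forall i, 'cV[R]_(n i) -> \bar R).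
Variables (A : forall i, 'M[R]_(l, n i)) (X : forall i, set 'cV[R]_(n i)).
Variables (b : 'cV[R]_l) (beta : R).

Definition objective (u : blocks R n) : \bar R :=
  (\sum_(i < m) theta (u i))%E.

Definition residual (u : blocks R n) : 'cV[R]_l :=
  \sum_(i < m) A i *m u i - b.

Definition feasible : set (blocks R n) :=
  [set u | (forall i, X (u i)) /\ \sum_(i < m) A i *m u i = b].

Definition solutions : set (blocks R n) := argmin objective feasible.

(* dom theta_1 x ... x dom theta_m, in R^(n_1 + ... + n_m) *)
Definition dom_prod : set 'cV[R]_(\sum_(i < m) n i) :=
  [set y | forall i, edom (@theta i) (submxcol y i)].

Definition W : set (point R l n) := [set w | forall i, X (w.1 i)].

Definition lagrangian (u : blocks R n) (z : 'cV[R]_l) : \bar R :=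
  (objective u - (dotp z (residual u))%:E)%E.

Definition aug_lagrangian (u : blocks R n) (z : 'cV[R]_l) : \bar R :=
  (objective u - (dotp z (residual u))%:E
   + (beta / 2 * enorm (residual u) ^+ 2)%:E)%E.

Definition saddle_points : set (point R l n) :=
  [set ws | W ws /\ forall w, W w ->
     (lagrangian ws.1 w.2 <= lagrangian ws.1 ws.2)%E /\
     (lagrangian ws.1 ws.2 <= lagrangian w.1 ws.2)%E].

(* (x_1^{k+1}, ..., x_{i-1}^{k+1}, y, x_{i+1}^k, ..., x_m^k) *)
Definition gauss_seidel (xk xk1 : blocks R n) (i : 'I_m) (y : 'cV[R]_(n i)) :
    blocks R n :=
  dfwith (fun j : 'I_m => if (j < i)%N then xk1 j else xk j) i y.

(* x 0 at the first block is not part of the initial data of the method, and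
   is never read: gauss_seidel overwrites it. *)
Definition eADMM (x : nat -> blocks R n) (z : nat -> 'cV[R]_l) : Prop :=
  forall k : nat,
    (forall i : 'I_m,
       argmin (fun y => aug_lagrangian (gauss_seidel (x k) (x k.+1) y) (z k))
              (@X i) (x k.+1 i)) /\
    z k.+1 = z k - beta *: residual (x k.+1).

Definition iterates_bounded (x : nat -> blocks R n) (z : nat -> 'cV[R]_l)
    (kappa : R) : Prop :=
  (forall (i : 'I_m) (k : nat), (0 < i)%N || (0 < k)%N ->
     enorm (A i *m x k i) <= kappa) /\
  (forall k : nat, enorm (z k) <= kappa).

Definition F (w : point R l n) : point R l n :=
  (fun i => - (A i)^T *m w.2, residual w.1).

Definition point_sub (w w' : point R l n) : point R l n :=
  (fun i => w.1 i - w'.1 i, w.2 - w'.2).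

Definition point_dot (w w' : point R l n) : R :=
  \sum_(i < m) dotp (w.1 i) (w'.1 i) + dotp w.2 w'.2.

(* ||v||_Q^2, where v = (x_2, ..., x_m, z) is w without its first block and
   Q = diag (beta A_2^T A_2, ..., beta A_m^T A_m, (1 / beta) I) *)
Definition vnormQ2 (w : point R l n) : R :=
  \sum_(i < m | (0 < i)%N) qnorm2 (beta *: ((A i)^T *m A i)) (w.1 i)
  + qnorm2 (beta^-1)%:M w.2.

(* Both averages run over the iterates of index 2, ..., t + 1. *)
Definition xavg (x : nat -> blocks R n) (t : nat) : blocks R n :=
  fun i => t%:R^-1 *: \sum_(1 <= k < t.+1) x k.+1 i.

Definition wavg (x : nat -> blocks R n) (z : nat -> 'cV[R]_l) (t : nat) :
    point R l n :=
  (xavg x t, t%:R^-1 *: \sum_(1 <= k < t.+1) z k.+1).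

(* i.+1 is the number of the block of index i, counting from 1. *)
Definition tau (i : 'I_m) : R :=
  (i.+1%:R - 3) / 2 + (7 + Num.sqrt 33) * (m%:R - 2) / 8.

Definition Cbar (x : nat -> blocks R n) : R :=
  beta * \sum_(i < m | (3 <= i.+1)%N)
           tau i * enorm (A i *m x 1%N i - A i *m x 0%N i) ^+ 2.

End problem.

(* Main.v *)
Require Import Defs.
From mathcomp Require Import ring lra.

Set Implicit Arguments.
Unset Strict Implicit.
Unset Printing Implicit Defensive.

Import Order.TTheory GRing.Theory Num.Theory.

Local Open Scope classical_set_scope.
Local Open Scope ring_scope.

(** Everything is read off a one-step inequality ([step_inequality]): along the
    iterates k+1, k+2, for every finite-valued w = (u, z) in W,

      theta(u^{k+2}) - theta(u) + (w^{k+2} - w)^T F(w)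
        <= beta r . sum_{i >= 2} A_i (x_i^{k+1} - x_i^{k+2})
           + Phi_k - Phi_{k+1},

    where r is the residual of u and Phi_k is half the squared Q-distance from
    v^{k+1} to v plus beta times the sum, over the strongly convex blocks, of
    tau_i |A_i (x_i^{k+1} - x_i^k)|^2.  Both groups on the right telescope.
    Summing, dropping the last potential and using convexity of the averages
    gives the bound of part 1; the factor 2 kappa (m - 1) is the crude estimate
    of the telescoped sum of the A_i x_i.

    The one-step inequality comes from the first-order conditions of the block
    subproblems ([prox_optimality], [block_optimality]), used three times for
    each block: at step k+2 tested with u, at step k+2 tested with x^{k+1}, and
    at step k+1 tested with x^{k+2}.  The first use produces everything up to
    cross terms between consecutive increments d_i and the errors e_i, together
    with - beta d_i . r^{k+2}.  The sum of the other two uses bounds this last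
    term, because z^{k+1} - z^{k+2} = beta r^{k+2}.  What remains is a quadratic
    form in d_i, in the previous increments and in e_i ([quadratic_bound]).
    The second block has no strong convexity, so its cross terms can only be
    paid by the square |d_2|^2 that the Q-norm releases; sharing this square
    among the m - 2 strongly convex blocks is possible because
    16 / (7 + s) + 8 / (5 + s) = 2 for s = sqrt 33 ([young_budget]).

    At a saddle point w the left-hand side is nonnegative and r = 0, so Phi_k is
    nonincreasing, which bounds the multipliers and the A_i x_i for i >= 2; the
    first block is then recovered from the residual ([iterates_bounded_exists]).
    The residual of an average is a telescoping sum of multipliers
    ([residual_avg_le]), whence part 2.  Part 3 combines the ergodic bound at
    (u*, 0) with the saddle inequality at the averaged point ([cost_gap]). *)

(** * Euclidean and spectral norms *)

Section dotp.
Context (R : realType) (N : nat).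
Implicit Types x y z : 'cV[R]_N.

Lemma dotpE x y : dotp x y = \sum_i x i 0 * y i 0.
Proof. by rewrite /dotp mxE; apply: eq_bigr => i _; rewrite mxE. Qed.

Lemma dotpC x y : dotp x y = dotp y x.
Proof. by rewrite !dotpE; apply: eq_bigr => i _; rewrite mulrC. Qed.

Lemma dotpDl x y z : dotp (x + y) z = dotp x z + dotp y z.
Proof. by rewrite /dotp linearD mulmxDl mxE. Qed.

Lemma dotpDr x y z : dotp x (y + z) = dotp x y + dotp x z.
Proof. by rewrite /dotp mulmxDr mxE. Qed.

Lemma dotpZl c x y : dotp (c *: x) y = c * dotp x y.
Proof. by rewrite /dotp linearZ -scalemxAl mxE. Qed.

Lemma dotpZr c x y : dotp x (c *: y) = c * dotp x y.
Proof. by rewrite dotpC dotpZl dotpC. Qed.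

Lemma dotpNl x y : dotp (- x) y = - dotp x y.
Proof. by rewrite -scaleN1r dotpZl mulN1r. Qed.

Lemma dotpNr x y : dotp x (- y) = - dotp x y.
Proof. by rewrite dotpC dotpNl dotpC. Qed.

Lemma dot0p x : dotp 0 x = 0.
Proof. by rewrite -(scale0r 0) dotpZl mul0r. Qed.

Lemma dotp0 x : dotp x 0 = 0.
Proof. by rewrite dotpC dot0p. Qed.

Definition dotp_lin := (dotpDl, dotpDr, dotpNl, dotpNr, dotpZl, dotpZr).

Lemma dotp_suml (I : Type) (r : seq I) (P : pred I) (f : I -> 'cV[R]_N) y :
  dotp (\sum_(i <- r | P i) f i) y = \sum_(i <- r | P i) dotp (f i) y.
Proof.
by elim/big_rec2: _ => [|i u v _ <-]; rewrite ?dot0p ?dotpDl.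
Qed.

Lemma dotp_sumr (I : Type) (r : seq I) (P : pred I) (f : I -> 'cV[R]_N) y :
  dotp y (\sum_(i <- r | P i) f i) = \sum_(i <- r | P i) dotp y (f i).
Proof. by rewrite dotpC dotp_suml; apply: eq_bigr => i _; rewrite dotpC. Qed.

Lemma dotp_ge0 x : 0 <= dotp x x.
Proof. by rewrite dotpE; apply: sumr_ge0 => i _; rewrite -expr2 sqr_ge0. Qed.

Lemma enorm_ge0 x : 0 <= enorm x.
Proof. exact: sqrtr_ge0. Qed.

Lemma enorm_sqr x : enorm x ^+ 2 = dotp x x.
Proof. by rewrite sqr_sqrtr // dotp_ge0. Qed.

Lemma enormN x : enorm (- x) = enorm x.
Proof. by rewrite /enorm dotpNl dotpNr opprK. Qed.

Lemma enormZ c x : enorm (c *: x) = `|c| * enorm x.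
Proof.
by rewrite /enorm dotpZl dotpZr mulrA -expr2 sqrtrM ?sqr_ge0 // sqrtr_sqr.
Qed.

Lemma enorm0_eq0 x : enorm x = 0 -> x = 0.
Proof.
move=> /(congr1 (fun c => c ^+ 2)); rewrite enorm_sqr expr0n /= dotpE => x0.
apply/colP => i; rewrite mxE; apply/eqP; rewrite -sqrf_eq0 expr2; apply/eqP.
have /psumr_eq0P -> // := x0; by move=> j _; rewrite -expr2 sqr_ge0.
Qed.

Lemma cauchy_schwarz x y : dotp x y <= enorm x * enorm y.
Proof.
have [x0|xN0] := eqVneq (enorm x) 0.
  by rewrite x0 mul0r (enorm0_eq0 x0) dot0p.
have [y0|yN0] := eqVneq (enorm y) 0.
  by rewrite y0 mulr0 (enorm0_eq0 y0) dotp0.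
have xy0 : 0 < enorm x * enorm y.
  by rewrite mulr_gt0 // lt0r ?xN0 ?yN0 enorm_ge0.
have := dotp_ge0 (enorm y *: x - enorm x *: y).
rewrite !dotp_lin -!enorm_sqr (dotpC y x) => h.
rewrite -(ler_pM2l xy0); lra.
Qed.

Lemma enormD x y : enorm (x + y) <= enorm x + enorm y.
Proof.
rewrite -ler_sqr ?nnegrE ?addr_ge0 ?enorm_ge0 // enorm_sqr !dotp_lin.
have := cauchy_schwarz x y; rewrite (dotpC y x) -!enorm_sqr; lra.
Qed.

Lemma enormB x y : enorm (x - y) <= enorm x + enorm y.
Proof. by rewrite -(enormN y) enormD. Qed.

Lemma enorm_sum (I : Type) (r : seq I) (P : pred I) (f : I -> 'cV[R]_N) :
  enorm (\sum_(i <- r | P i) f i) <= \sum_(i <- r | P i) enorm (f i).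
Proof.
elim/big_rec2: _ => [|i u v _ h]; first by rewrite /enorm dotp0 sqrtr0.
by rewrite (le_trans (enormD _ _)) // lerD2l.
Qed.

(** The weighted Young inequality, from the square of 2 k y - x. *)
Lemma young x y (k : R) : 0 < k ->
  dotp x y <= (4 * k)^-1 * dotp x x + k * dotp y y.
Proof.
move=> k0; have := dotp_ge0 (2 * k *: y - x).
rewrite !dotp_lin (dotpC y x) => h.
have k4 : 0 < 4 * k by lra.
rewrite -(ler_pM2l k4) mulrDr mulrA mulfV ?gt_eqF // mul1r; lra.
Qed.

End dotp.

Lemma dotp_trmx (R : realType) (p q : nat) (M : 'M[R]_(p, q)) x y :
  dotp x (M^T *m y) = dotp (M *m x) y.
Proof. by rewrite /dotp trmx_mul -!mulmxA. Qed.

Section spectral_norm.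
Context (R : realType) (p q : nat).
Implicit Types M : 'M[R]_(p, q).

(** Without an upper bound the supremum defining the spectral norm would be the
    junk value 0; the entries of a vector of the unit ball are at most 1, so the
    norms of the columns add up to a bound. *)
Lemma spectral_norm_has_ubound M :
  has_ubound [set enorm (M *m x) | x in [set x : 'cV[R]_q | enorm x <= 1]].
Proof.
exists (\sum_j enorm (col j M)) => _ [x /= x1 <-].
have -> : M *m x = \sum_j x j 0 *: col j M.
  apply/colP => i; rewrite !mxE summxE; apply: eq_bigr => j _.
  by rewrite !mxE mulrC.
apply: (le_trans (enorm_sum _ _ _)); apply: ler_sum => j _.
rewrite enormZ ler_piMl ?enorm_ge0 //.
apply: le_trans x1; rewrite -ler_sqr ?nnegrE ?enorm_ge0 //.
rewrite enorm_sqr dotpE (bigD1 j) //= -normrX ger0_norm ?sqr_ge0 //.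
by rewrite -expr2 lerDl sumr_ge0 // => i _; rewrite -expr2 sqr_ge0.
Qed.

Lemma spectral_norm_ge0 M : 0 <= spectral_norm M.
Proof.
apply: (ub_le_sup (spectral_norm_has_ubound M)).
exists 0; first by rewrite /= /enorm dotp0 sqrtr0.
by rewrite mulmx0 /enorm dotp0 sqrtr0.
Qed.

Lemma enorm_mulmx_le M x : enorm (M *m x) <= spectral_norm M * enorm x.
Proof.
have [x0|xN0] := eqVneq (enorm x) 0.
  by rewrite x0 mulr0 (enorm0_eq0 x0) mulmx0 /enorm dotp0 sqrtr0.
have x0 : 0 < enorm x by rewrite lt0r xN0 enorm_ge0.
rewrite -ler_pdivrMr //.
apply: (ub_le_sup (spectral_norm_has_ubound M)).
exists ((enorm x)^-1 *: x) => /=.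
  by rewrite enormZ gtr0_norm ?invr_gt0 // mulVf.
by rewrite -scalemxAr enormZ gtr0_norm ?invr_gt0 // mulrC.
Qed.

End spectral_norm.

(** What turns strong convexity in x_i into strong convexity in A_i x_i. *)
Lemma dotp_mulmx_le (R : realType) (p q : nat) (M : 'M[R]_(p, q)) x :
  dotp (M *m x) (M *m x) <= spectral_norm (M^T *m M) * dotp x x.
Proof.
rewrite -dotp_trmx mulmxA; apply: (le_trans (cauchy_schwarz _ _)).
rewrite -enorm_sqr expr2 mulrCA ler_wpM2l ?enorm_ge0 //.
exact: enorm_mulmx_le.
Qed.

(** * The quadratic form of the cross terms *)

Lemma sum_ord_range (V : nmodType) (m p q : nat) (y : V) : (q <= m)%N ->
  \sum_(i < m | (p <= i < q)%N) y = y *+ (q - p).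
Proof.
move=> qm;
  rewrite -(big_mkord (fun i => p <= i < q)%N (fun=> y)).
by rewrite -sumr_const_nat (big_nat_widenl p 0) // (big_nat_widen 0 q m) //.
Qed.

(** The coefficient c of the step size condition beta c |A_i^T A_i| < mu_i: the
    strong convexity of block i is worth c beta |A_i v|^2. *)
Definition stepsize_coef (R : realType) (m : nat) : R :=
  (13 + Num.sqrt 33) / 4 * m%:R - (17 + Num.sqrt 33) / 2.

Lemma stepsize_coef_gt0 (R : realType) (m : nat) : (3 <= m)%N ->
  0 < stepsize_coef R m.
Proof.
move=> m3; rewrite /stepsize_coef.
have s0 : 0 <= Num.sqrt 33 :> R by exact: sqrtr_ge0.
have hm : 3 <= m%:R :> R by rewrite ler_nat.
have : 0 <= Num.sqrt 33 * (m%:R - 3) :> R by rewrite mulr_ge0 // subr_ge0.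
lra.
Qed.

(** The equation that selects s = sqrt 33.  With p = m - 2, the squares of the two
    increments of a strongly convex block are available in [quadratic_bound]
    with coefficient at least k = (7 + s) p / 8, and the square of its error
    with coefficient at least k' = (5 + s) p / 8.  Young's inequality then
    charges 1 / (4 k) twice and 1 / (4 k') once to |d_2|^2, and these charges
    have to fit into the share 1 / (2 p) of one block. *)
Lemma young_budget (R : realType) (p : R) : 0 < p ->
  2 * (4 * ((7 + Num.sqrt 33) * p / 8))^-1
  + (4 * ((5 + Num.sqrt 33) * p / 8))^-1
  = (2 * p)^-1.
Proof.
move=> p0; have s0 : 0 <= Num.sqrt 33 :> R by exact: sqrtr_ge0.
have s2 : Num.sqrt 33 ^+ 2 = 33 :> R by rewrite sqr_sqrtr.
set s := Num.sqrt 33 in s0 s2 *.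
have -> : 2 * (4 * ((7 + s) * p / 8))^-1 + (4 * ((5 + s) * p / 8))^-1
  = (2 * p)^-1 * ((68 + 12 * s) / (35 + 12 * s + s ^+ 2)).
  field.
  apply/and4P; split; rewrite gt_eqF //; nra.
by rewrite s2 (_ : 35 + 12 * s + 33 = 68 + 12 * s) ?divff ?mulr1 ?gt_eqF //; lra.
Qed.

Section quadratic.
Context (R : realType) (l m : nat).
Implicit Types d e : 'I_m -> 'cV[R]_l.

(** The bound on the cross terms.  Below, d, d' and e stand for the new
    increments, the previous increments and the errors.  The pairs i < j of
    strongly convex blocks are split evenly; there are j - 2 indices before j
    and m - 1 - j after it (indices starting from 0), which is where the first
    summand of tau comes from.  The pairs with i = 1 use [young_budget]. *)
Lemma quadratic_bound (hm : (3 <= m)%N) d d' e :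
  \sum_(i < m | (0 < i)%N)
     (dotp (d i) (\sum_(j < m | (i < j)%N) (d j - d' j - e j))
      - 2^-1 * dotp (d i) (d i))
  <= \sum_(i < m | (1 < i)%N)
       (tau R i * (dotp (d' i) (d' i) - dotp (d i) (d i))
        + stepsize_coef R m * dotp (d i) (d i)
        + stepsize_coef R m / 2 * dotp (e i) (e i)).
Proof.
have m1 : (1 < m)%N by exact: ltnW.
pose o := Ordinal m1.
pose T i j := dotp (d i) (d j) - dotp (d i) (d' j) - dotp (d i) (e j).
have T_le i j : T i j <= 3 / 2 * dotp (d i) (d i)
    + 2^-1 * (dotp (d j) (d j) + dotp (d' j) (d' j) + dotp (e j) (e j)).
  have h1 := dotp_ge0 (d i - d j); have h2 := dotp_ge0 (d i + d' j).
  have h3 := dotp_ge0 (d i + e j); move: h1 h2 h3; rewrite !dotp_lin /T.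
  rewrite (dotpC (d j) (d i)) (dotpC (d' j) (d i)) (dotpC (e j) (d i)); lra.
have split1 (G : 'I_m -> R) : \sum_(i < m | (0 < i)%N) G i
    = G o + \sum_(i < m | (1 < i)%N) G i.
  rewrite (bigD1 o) //=; congr (_ + _); apply: eq_bigl => i.
  by rewrite -val_eqE /=; case: (nat_of_ord i) => [|[]].
have dbl : \sum_(i < m | (0 < i)%N) \sum_(j < m | (i < j)%N) T i j
   = \sum_(j < m | (1 < j)%N) T o j
     + \sum_(j < m | (1 < j)%N) \sum_(i < m | (1 < i < j)%N) T i j.
  rewrite split1; congr (_ + _).
  rewrite (exchange_big_dep (fun j : 'I_m => 1 < j)%N) //=.
  by move=> i j i1 ij; apply: ltn_trans ij.
have p0 : 0 < m%:R - 2 :> R by rewrite subr_gt0 ltr_nat.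
(* The square of the increment of block o is divided equally among the m - 2
   later blocks. *)
have o_share : \sum_(j < m | (1 < j)%N) (2 * (m%:R - 2))^-1 * dotp (d o) (d o)
    = 2^-1 * dotp (d o) (d o).
  have -> : \sum_(j < m | (1 < j)%N) (2 * (m%:R - 2))^-1 * dotp (d o) (d o)
    = \sum_(j < m | (2 <= j < m)%N) (2 * (m%:R - 2))^-1 * dotp (d o) (d o).
    by apply: eq_bigl => j; rewrite ltn_ord andbT.
  rewrite sum_ord_range // -(mulr_natr _ (m - 2)) natrB 1?ltnW //; field.
  by rewrite gt_eqF.
have dbl_le : \sum_(j < m | (1 < j)%N) \sum_(i < m | (1 < i < j)%N) T i j
   <= \sum_(j < m | (1 < j)%N) ((m%:R - 1 - j%:R) * (3 / 2 * dotp (d j) (d j))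
      + (j%:R - 2) * (2^-1 * (dotp (d j) (d j) + dotp (d' j) (d' j)
                              + dotp (e j) (e j)))).
  rewrite big_split /=.
  have -> : \sum_(i < m | (1 < i)%N)
        (m%:R - 1 - i%:R) * (3 / 2 * dotp (d i) (d i))
     = \sum_(i < m | (1 < i)%N)
        \sum_(j < m | (i < j)%N) (3 / 2 * dotp (d i) (d i)).
    apply: eq_bigr => i i1.
    transitivity (\sum_(j < m | (i.+1 <= j < m)%N) (3 / 2 * dotp (d i) (d i))).
      rewrite sum_ord_range // -(mulr_natl _ (m - i.+1)) natrB ?ltn_ord //.
      congr (_ * _).
      by rewrite -natr1; lra.
    by apply: eq_bigl => j; rewrite ltn_ord andbT.
  rewrite [X in _ <= X + _](exchange_big_dep (fun j : 'I_m => 1 < j)%N) /=;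
    last first.
    by move=> i j i1 ij; apply: ltn_trans ij.
  rewrite -big_split /=; apply: ler_sum => j j1.
  rewrite [X in _ + X](_ : _ = \sum_(i < m | (1 < i < j)%N)
     (2^-1 * (dotp (d j) (d j) + dotp (d' j) (d' j) + dotp (e j) (e j)))).
    by rewrite -big_split /=; apply: ler_sum.
  by rewrite sum_ord_range 1?ltnW // -(mulr_natl _ (j - 2)) natrB.
rewrite big_split /= sumrN (split1 (fun i => 2^-1 * dotp (d i) (d i))).
under eq_bigr => i _.
  rewrite dotp_sumr; under eq_bigr => j _ do rewrite !dotp_lin -/(T i j).
  over.
rewrite dbl -o_share.
apply: (@le_trans _ _ (\sum_(j < m | (1 < j)%N) (T o j
      + ((m%:R - 1 - j%:R) * (3 / 2 * dotp (d j) (d j))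
      + (j%:R - 2) * (2^-1 * (dotp (d j) (d j) + dotp (d' j) (d' j)
                              + dotp (e j) (e j))))
      - ((2 * (m%:R - 2))^-1 * dotp (d o) (d o) + 2^-1 * dotp (d j) (d j))))).
  rewrite [leRHS]big_split [X in _ <= X + _]big_split /= sumrN.
  rewrite [X in _ <= _ - X]big_split /=.
  by rewrite lerD2r lerD2l.
apply: ler_sum => j j1.
have s0 : 0 <= Num.sqrt 33 :> R by exact: sqrtr_ge0.
pose k := (7 + Num.sqrt 33) * (m%:R - 2) / 8 : R.
pose k' := (5 + Num.sqrt 33) * (m%:R - 2) / 8 : R.
have k0 : 0 < k by rewrite divr_gt0 // mulr_gt0 //; lra.
have k'0 : 0 < k' by rewrite divr_gt0 // mulr_gt0 //; lra.
have y1 := young (d o) (d j) k0.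
have y2 := young (d o) (- d' j) k0.
have y3 := young (d o) (- e j) k'0.
rewrite !dotp_lin ?opprK in y2 y3.
have q0 : 0 <= j%:R - 2 :> R by rewrite subr_ge0 ler_nat.
have qm : j%:R - 2 <= m%:R - 3 :> R.
  have : j.+1%:R <= m%:R :> R by rewrite ler_nat.
  by rewrite -natr1; lra.
have bud := young_budget p0; rewrite -/k -/k' in bud.
rewrite -bud /T /stepsize_coef /tau -natr1.
have h1 := mulr_ge0 q0 (dotp_ge0 (d j)).
have h2 : 0 <= (m%:R - 3 - (j%:R - 2)) * dotp (e j) (e j).
  by rewrite mulr_ge0 ?dotp_ge0 // subr_ge0.
have h3 : 0 <= (m%:R - 3) * dotp (e j) (e j).
  by rewrite mulr_ge0 ?dotp_ge0 // subr_ge0 ler_nat.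
move: y1 y2 y3; set K := (4 * k)^-1; set K' := (4 * k')^-1; rewrite /k /k'.
lra.
Qed.

End quadratic.

(** * One step of the iteration in image space *)

Section descent.
Context (R : realType) (l m : nat) (b : 'cV[R]_l) (beta : R).
Implicit Types a : 'I_m -> 'cV[R]_l.

(** A strong convexity modulus of block i with respect to A_i x_i. *)
Definition block_modulus (i : 'I_m) : R :=
  (stepsize_coef R m * beta) *+ (1 < i)%N.

(** The multiplier seen by block i: as the blocks after i still have their old
    values when block i is updated, its first-order condition involves z'
    shifted by their increments. *)
Definition gs_dual a a' (z' : 'cV[R]_l) (i : 'I_m) : 'cV[R]_l :=
  z' + beta *: \sum_(j < m | (i < j)%N) (a' j - a j).

(** The Lyapunov function of the iteration; al and zz are the images A_i x_i and
    the multiplier of the reference point, a and a' those of two consecutive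
    iterates. *)
Definition potential al (zz : 'cV[R]_l) a a' (z' : 'cV[R]_l) : R :=
  2^-1 * (\sum_(i < m | (0 < i)%N) beta * dotp (a' i - al i) (a' i - al i)
          + beta^-1 * dotp (z' - zz) (z' - zz))
  + beta * \sum_(i < m | (1 < i)%N) tau R i * dotp (a' i - a i) (a' i - a i).

(** Summation by columns: the errors of the blocks before j are all the errors
    minus those from j on, which isolates the total error, a difference of
    residuals. *)
Lemma gs_exchange (d e : 'I_m -> 'cV[R]_l) :
  \sum_i dotp (e i) (\sum_(j < m | (i < j)%N) d j) =
  \sum_(j < m | (0 < j)%N) (dotp (d j) (\sum_i e i) - dotp (d j) (e j)
                             - dotp (d j) (\sum_(i < m | (j < i)%N) e i)).
Proof.
under eq_bigr do rewrite dotp_sumr.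
rewrite (exchange_big_dep (fun j : 'I_m => 0 < j)%N) /=; last first.
  by move=> i j _; apply: leq_ltn_trans.
apply: eq_bigr => j _.
have -> : \sum_i e i = \sum_(i < m | (i < j)%N) e i
    + (e j + \sum_(i < m | (j < i)%N) e i).
  rewrite (bigID (fun i : 'I_m => i < j)%N) /=; congr (_ + _).
  rewrite (bigD1 j) ?ltnn //=; congr (_ + _); apply: eq_bigl => i.
  by rewrite -leqNgt ltn_neqAle andbC eq_sym.
rewrite !dotpDr dotp_sumr.
by under eq_bigr do rewrite dotpC; ring.
Qed.

(** The one-step inequality in terms of the images A_i x_i only.  The three
    families of hypotheses are the first-order conditions at a2 tested with the
    reference point, at a2 tested with a1, and at a1 tested with a2. *)
Lemma descent_step (hm : (3 <= m)%N) (beta0 : 0 < beta) a0 a1 a2 al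
    (z1 z2 zz : 'cV[R]_l) (t1 t2 tl : 'I_m -> R) :
  z2 = z1 - beta *: (\sum_i a2 i - b) ->
  (forall i, block_modulus i / 2 * dotp (a2 i - al i) (a2 i - al i) <=
     tl i - t2 i + dotp (a2 i - al i) (gs_dual a1 a2 z2 i)) ->
  (forall i, block_modulus i / 2 * dotp (a2 i - a1 i) (a2 i - a1 i) <=
     t1 i - t2 i + dotp (a2 i - a1 i) (gs_dual a1 a2 z2 i)) ->
  (forall i, block_modulus i / 2 * dotp (a1 i - a2 i) (a1 i - a2 i) <=
     t2 i - t1 i + dotp (a1 i - a2 i) (gs_dual a0 a1 z1 i)) ->
  \sum_i (t2 i - tl i) + (dotp z2 (\sum_i al i - b) - dotp zz (\sum_i a2 i - b))
  <= beta * dotp (\sum_i al i - b) (\sum_(i < m | (0 < i)%N) (a1 i - a2 i))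
     + (potential al zz a0 a1 z1 - potential al zz a1 a2 z2).
Proof.
set r2 := \sum_i a2 i - b; set r := \sum_i al i - b.
move=> z2E h1 h2 h3.
pose d i := a2 i - a1 i; pose d' i := a1 i - a0 i; pose e i := a2 i - al i.
have sum_e : \sum_i e i = r2 - r by rewrite sumrB /r2 /r opprB addrA subrK.
clearbody r r2.
have sum_mod f : \sum_i block_modulus i * f i =
    stepsize_coef R m * beta * \sum_(i < m | (1 < i)%N) f i.
  rewrite mulr_sumr big_mkcond [RHS]big_mkcond /=; apply: eq_bigr => i _.
  by rewrite /block_modulus; case: (1 < i)%N; rewrite ?mulr1n ?mulr0n ?mul0r.
have sum_h1 : stepsize_coef R m * beta
     * \sum_(i < m | (1 < i)%N) (2^-1 * dotp (e i) (e i))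
   <= \sum_i (tl i - t2 i) + dotp (r2 - r) z2
      + beta * \sum_i dotp (e i) (\sum_(j < m | (i < j)%N) d j).
  rewrite -sum_mod -sum_e dotp_suml mulr_sumr -!big_split /=.
  apply: ler_sum => i _.
  by have := h1 i; rewrite -/(e i) /gs_dual dotpDr dotpZr; lra.
(* The two conditions between consecutive iterates: the cost differences cancel
   and the multipliers differ by beta r2. *)
have sum_h2 : beta * \sum_(i < m | (0 < i)%N) dotp (d i) r2 +
     stepsize_coef R m * beta * \sum_(i < m | (1 < i)%N) dotp (d i) (d i) <=
   beta * \sum_(i < m | (0 < i)%N)
       dotp (d i) (\sum_(j < m | (i < j)%N) (d j - d' j)).
  rewrite -sum_mod.
  rewrite (_ : \sum_i block_modulus i * dotp (d i) (d i) =
    \sum_(i < m | (0 < i)%N) block_modulus i * dotp (d i) (d i)); last first.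
    rewrite [RHS]big_mkcond; apply: eq_bigr => i _.
    rewrite /block_modulus; case: ltnP => [/ltnW ->//|_].
    by rewrite mul0r if_same.
  rewrite !mulr_sumr -big_split /=; apply: ler_sum => i _.
  have := lerD (h2 i) (h3 i); rewrite -(opprB (a2 i) (a1 i)) -/(d i).
  rewrite sumrB /gs_dual z2E -/r2 !dotp_lin -/d -/d'; lra.
(* Polarization of the squared distances; the dual part leaves beta / 2 |r2|^2,
   which is dropped at the end. *)
have pot : potential al zz a0 a1 z1 - potential al zz a1 a2 z2 =
  beta * (2^-1 * \sum_(i < m | (0 < i)%N) dotp (d i) (d i)
          - \sum_(i < m | (0 < i)%N) dotp (d i) (e i))
  + (dotp r2 (z2 - zz) + beta / 2 * dotp r2 r2)
  + beta * \sum_(i < m | (1 < i)%N)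
      tau R i * (dotp (d' i) (d' i) - dotp (d i) (d i)).
  have -> : dotp r2 (z2 - zz) + beta / 2 * dotp r2 r2 =
      2^-1 * (beta^-1 * dotp (z1 - zz) (z1 - zz)
              - beta^-1 * dotp (z2 - zz) (z2 - zz)).
    have -> : z1 - zz = (z2 - zz) + beta *: r2 by rewrite z2E addrAC subrK.
    move: (z2 - zz) => y; rewrite !dotp_lin (dotpC y r2).
    by field; rewrite gt_eqF.
  have -> : 2^-1 * \sum_(i < m | (0 < i)%N) dotp (d i) (d i)
          - \sum_(i < m | (0 < i)%N) dotp (d i) (e i) =
     2^-1 * (\sum_(i < m | (0 < i)%N) dotp (a1 i - al i) (a1 i - al i)
             - \sum_(i < m | (0 < i)%N) dotp (e i) (e i)).
    rewrite -sumrB !mulr_sumr -sumrB; apply: eq_bigr => i _.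
    have -> : a1 i - al i = e i - d i by rewrite /e /d opprB [RHS]addrC addrA subrK.
    by move: (e i) (d i) => y v; rewrite !dotp_lin (dotpC y v); field.
  have -> : \sum_(i < m | (1 < i)%N)
      tau R i * (dotp (d' i) (d' i) - dotp (d i) (d i)) =
    \sum_(i < m | (1 < i)%N) tau R i * dotp (d' i) (d' i) -
    \sum_(i < m | (1 < i)%N) tau R i * dotp (d i) (d i).
    by rewrite -sumrB; apply: eq_bigr => i _; rewrite mulrBr.
  rewrite /potential -!mulr_sumr -/(d _) -/(d' _) -/(e _); ring.
have quad := quadratic_bound hm d d' e.
rewrite pot.
have quad' : \sum_(i < m | (0 < i)%N)
     dotp (d i) (\sum_(j < m | (i < j)%N) (d j - d' j))
   - \sum_(i < m | (0 < i)%N) dotp (d i) (\sum_(j < m | (i < j)%N) e j)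
   - 2^-1 * \sum_(i < m | (0 < i)%N) dotp (d i) (d i)
  <= \sum_(i < m | (1 < i)%N)
       tau R i * (dotp (d' i) (d' i) - dotp (d i) (d i))
    + stepsize_coef R m * \sum_(i < m | (1 < i)%N) dotp (d i) (d i)
    + stepsize_coef R m * \sum_(i < m | (1 < i)%N) (2^-1 * dotp (e i) (e i)).
  rewrite !mulr_sumr -!big_split -!sumrB /=.
  apply: le_trans (le_trans _ quad) _; apply: ler_sum => i _.
    by rewrite [X in _ <= dotp _ X - _]sumrB [X in _ <= X - _]dotpDr dotpNr.
  by rewrite [X in _ <= _ + X]mulrA.
rewrite gs_exchange sum_e in sum_h1.
move: (ler_wpM2l (ltW beta0) quad').
have -> : dotp r (\sum_(i < m | (0 < i)%N) (a1 i - a2 i))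
   = - \sum_(i < m | (0 < i)%N) dotp (d i) r.
  rewrite dotp_sumr -sumrN; apply: eq_bigr => i _.
  by rewrite -dotpNl opprB dotpC.
rewrite [\sum_i (t2 i - tl i)](_ : _ = - \sum_i (tl i - t2 i)); last first.
  by rewrite -sumrN; apply: eq_bigr => i _; rewrite opprB.
move: sum_h1 sum_h2; rewrite !sumrB.
have -> : \sum_(i < m | (0 < i)%N) dotp (d i) (r2 - r) =
   \sum_(i < m | (0 < i)%N) dotp (d i) r2
   - \sum_(i < m | (0 < i)%N) dotp (d i) r.
  by rewrite -sumrB; apply: eq_bigr => i _; rewrite dotpDr dotpNr.
have := mulr_ge0 (ltW beta0) (dotp_ge0 r2).
rewrite !dotp_lin (dotpC zz) (dotpC z2); lra.
Qed.
End descent.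

(** * Convexity: optimality conditions and averages *)

(** The passage to the limit of a first-order optimality condition. *)
Lemma ge0_of_small_steps (R : realFieldType) (p q : R) :
  (forall t, 0 < t <= 1 -> 0 <= p + t * q) -> 0 <= p.
Proof.
move=> h; rewrite leNgt; apply/negP => p0.
have nq : 0 <= `|q| by [].
have den0 : 0 < 2 * (`|q| - p) by lra.
pose t := - p / (2 * (`|q| - p)).
have t01 : 0 < t <= 1.
  by rewrite divr_gt0 ?oppr_gt0 //= ler_pdivrMr // mul1r; lra.
have := h t t01; apply/negP; rewrite -ltNge.
have tq : t * q <= - p / 2.
  have : t * q <= t * (`|q| - p).
    rewrite ler_wpM2l //; first by case/andP: t01 => /ltW.
    by have := ler_norm q; lra.
  suff -> : t * (`|q| - p) = - p / 2 by [].
  by rewrite /t; field; lra.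
lra.
Qed.

Section convexity.
Context (R : realType) (N : nat).
Implicit Types (f : 'cV[R]_N -> \bar R) (C : set 'cV[R]_N) (x y : 'cV[R]_N).

Lemma convex_strongly_convex0 f : convex f -> strongly_convex 0 f.
Proof. by move=> cf x y t t01; rewrite !mul0r sube0; exact: cf. Qed.

Lemma convex_set_comb C x y (t : R) : @convex_set R 'cV[R]_N C ->
  C x -> C y -> 0 <= t <= 1 -> C (t *: x + (1 - t) *: y).
Proof.
move=> cC Cx Cy /andP[t0 t1].
have := cC x y (Itv01 t0 t1); rewrite !inE; exact.
Qed.

Lemma strongly_convex_fine f mu x y (t : R) :
  (forall v, (-oo < f v)%E) -> strongly_convex mu f -> 0 <= t <= 1 ->
  f x \is a fin_num -> f y \is a fin_num ->
  f (t *: x + (1 - t) *: y) \is a fin_num /\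
  fine (f (t *: x + (1 - t) *: y)) <= t * fine (f x) + (1 - t) * fine (f y)
     - mu / 2 * t * (1 - t) * dotp (x - y) (x - y).
Proof.
move=> pf cf t01 fx fy; have := cf x y t t01; have := pf (t *: x + (1 - t) *: y).
rewrite enorm_sqr -(fineK fx) -(fineK fy) -!EFinM -!EFinD /=.
case: (f (t *: x + _)) => [v| |] //= _; rewrite lee_fin; by [].
Qed.

(** Jensen's inequality for uniform averages, by induction on their length:
    the average of t + 1 points is a convex combination of the average of the
    first t, with weight t / (t + 1), and the last one. *)
Lemma average_in_convex f C (y : nat -> 'cV[R]_N) (t : nat) :
  (forall v, (-oo < f v)%E) -> convex f -> @convex_set R 'cV[R]_N C ->
  (forall k, (0 < k)%N -> C (y k) /\ f (y k) \is a fin_num) -> (0 < t)%N ->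
  let avg := t%:R^-1 *: \sum_(1 <= k < t.+1) y k in
  [/\ C avg, f avg \is a fin_num &
      fine (f avg) <= t%:R^-1 * \sum_(1 <= k < t.+1) fine (f (y k))].
Proof.
move=> pf cf cC Cy /=; elim: t => // -[_ _|t /(_ isT) [Ca fa le_a] _].
  by rewrite !big_nat1 invr1 scale1r mul1r; have [] := Cy 1%N isT.
have [Cn fn] := Cy t.+2 isT.
pose lam : R := t.+1%:R / t.+2%:R.
have t1 : 0 < t.+1%:R :> R by rewrite ltr0n.
have t2 : 0 < t.+2%:R :> R by rewrite ltr0n.
have lam01 : 0 <= lam <= 1.
  by rewrite divr_ge0 ?ler0n //= ler_pdivrMr // mul1r ler_nat.
have lam1 : 1 - lam = t.+2%:R^-1.
  apply: (mulIf (lt0r_neq0 t2)); rewrite mulrBl mul1r divfK ?gt_eqF //.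
  by rewrite mulVf ?gt_eqF // -[t.+2%:R]natr1 addrAC subrr add0r.
have lamt : lam * t.+1%:R^-1 = t.+2%:R^-1.
  by rewrite /lam mulrAC divff ?mul1r // gt_eqF.
have := convex_set_comb cC Ca Cn lam01.
have := strongly_convex_fine pf (convex_strongly_convex0 cf) lam01 fa fn.
rewrite !mul0r subr0 scalerA lam1 lamt -scalerDr -big_nat_recr //= => -[ff le_f].
split=> //; apply: (le_trans le_f).
rewrite [leRHS](_ : _ = lam * (t.+1%:R^-1 * \sum_(1 <= k < t.+2) fine (f (y k)))
   + t.+2%:R^-1 * fine (f (y t.+2))).
  by rewrite lerD2r ler_wpM2l //; case/andP: lam01.
by rewrite mulrA lamt -mulrDr -big_nat_recr.
Qed.

(** First-order optimality without subgradients: compare x with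
    t y + (1 - t) x, divide by t and let t tend to 0.  Convexity of f is used
    only along this segment, so f need not be differentiable anywhere. *)
Lemma prox_optimality l f C (M : 'M[R]_(l, N)) (rho z : 'cV[R]_l) beta mu x :
  (forall v, (-oo < f v)%E) -> strongly_convex mu f ->
  @convex_set R 'cV[R]_N C -> C x -> f x \is a fin_num ->
  (forall y, C y -> f y \is a fin_num ->
     fine (f x) - dotp z (M *m x + rho)
       + beta / 2 * dotp (M *m x + rho) (M *m x + rho) <=
     fine (f y) - dotp z (M *m y + rho)
       + beta / 2 * dotp (M *m y + rho) (M *m y + rho)) ->
  forall y, C y -> f y \is a fin_num ->
    mu / 2 * dotp (x - y) (x - y) <= fine (f y) - fine (f x)
      + dotp (M *m x - M *m y) (z - beta *: (M *m x + rho)).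
Proof.
move=> pf sf cC Cx fx xmin y Cy fy.
rewrite -subr_ge0.
pose g := M *m y - M *m x.
apply: (@ge0_of_small_steps _ _ (beta / 2 * dotp g g
   + mu / 2 * dotp (x - y) (x - y))) => t /andP[t0 t1].
have t01 : 0 <= t <= 1 by rewrite ltW.
have [fc le_c] := strongly_convex_fine pf sf t01 fy fx.
have := xmin _ (convex_set_comb cC Cy Cx t01) fc.
have -> : M *m (t *: y + (1 - t) *: x) + rho = (M *m x + rho) + t *: g.
  rewrite mulmxDr -!scalemxAr /g scalerBr scalerBl scale1r.
  by rewrite addrCA addrAC.
have -> : M *m x - M *m y = - g by rewrite opprB.
move: le_c; rewrite -(opprB x y) dotpNl dotpNr opprK.
clearbody g; move: (M *m x + rho) (dotp (x - y) (x - y)) => h D le_c.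
rewrite !dotp_lin (dotpC g h) (dotpC g z) => le_x.
rewrite -(pmulr_rge0 _ t0); lra.
Qed.

End convexity.

(** * Optimality of the block updates *)

Section admm.
Context (R : realType) (m l : nat) (n : 'I_m -> nat).
Context (theta : forall i : 'I_m, 'cV[R]_(n i) -> \bar R).
Context (A : forall i : 'I_m, 'M[R]_(l, n i)).
Context (X : forall i : 'I_m, set 'cV[R]_(n i)).
Context (b : 'cV[R]_l) (beta : R).
Arguments theta : clear implicits.
Arguments X : clear implicits.
Context (theta_gtNy : forall i y, (-oo < theta i y)%E).

(** A sum of extended reals none of which is -oo is finite only if all are. *)
Lemma objective_fin_num (u : blocks R n) : (objective theta u < +oo)%E ->
  forall i, theta i (u i) \is a fin_num.
Proof.
move=> uy i.
have /sum_fin_numP : objective theta u \is a fin_num.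
  rewrite fin_numElt uy andbT ltNye esum_eqNy; apply/existsP => -[j /=].
  by move=> /eqP thetaNy; have := theta_gtNy (u j); rewrite thetaNy.
by apply=> //; exact: mem_index_enum.
Qed.

Lemma objective_fine (u : blocks R n) :
  (forall i, theta i (u i) \is a fin_num) ->
  objective theta u = (\sum_i fine (theta i (u i)))%:E.
Proof. by move=> fu; rewrite EFin_sum_fine. Qed.

Lemma aug_lagrangian_lty (u : blocks R n) z :
  (aug_lagrangian theta A b beta u z < +oo)%E ->
  forall i, theta i (u i) \is a fin_num.
Proof.
move=> uy; apply: objective_fin_num; move: uy; rewrite /aug_lagrangian.
by case: (objective theta u) => [r||] // _; rewrite ?ltry ?ltNyr.
Qed.

Lemma aug_lagrangian_fine (u : blocks R n) z :
  (forall i, theta i (u i) \is a fin_num) ->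
  aug_lagrangian theta A b beta u z =
  (\sum_i fine (theta i (u i)) - dotp z (residual A b u)
   + beta / 2 * dotp (residual A b u) (residual A b u))%:E.
Proof. by move=> fu; rewrite /aug_lagrangian objective_fine // enorm_sqr. Qed.

Section iterates.
Context (x : nat -> blocks R n) (z : nat -> 'cV[R]_l).
Context (admm : eADMM theta A X b beta x z).

(** At k = 0 this includes finiteness at the starting blocks x_2^0, ..., x_m^0:
    otherwise the first subproblem would have no minimizer. *)
Lemma gauss_seidel_fin_num k i j :
  theta j (gauss_seidel (x k) (x k.+1) (x k.+1 i) j) \is a fin_num.
Proof. by have [/(_ i) [_ gsy _] _] := admm k; exact: aug_lagrangian_lty gsy j. Qed.

Lemma iterate_feasible k i :
  X i (x k.+1 i) /\ theta i (x k.+1 i) \is a fin_num.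
Proof.
split; first by have [/(_ i) []] := admm k.
by have := gauss_seidel_fin_num k i i; rewrite /gauss_seidel dfwithin.
Qed.

(** The residual seen by block i is r^{k+1} minus the increments of the later
    blocks, so z^k minus beta times it is the shifted multiplier [gs_dual]. *)
Lemma block_optimality k (i : 'I_m) mu :
  strongly_convex mu (theta i) -> @convex_set R 'cV[R]_(n i) (X i) ->
  forall y, X i y -> theta i y \is a fin_num ->
  mu / 2 * dotp (x k.+1 i - y) (x k.+1 i - y) <=
  fine (theta i y) - fine (theta i (x k.+1 i))
  + dotp (A i *m x k.+1 i - A i *m y)
      (gs_dual beta (fun j => A j *m x k j) (fun j => A j *m x k.+1 j)
         (z k.+1) i).
Proof.
move=> si ci y Xy fy.
have [Xx fx] := iterate_feasible k i.
pose gs := gauss_seidel (x k) (x k.+1).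
pose rho := \sum_(j | j != i) A j *m gs i (x k.+1 i) j - b.
have gs_ne (v : 'cV[R]_(n i)) j : j != i -> gs i v j = gs i (x k.+1 i) j.
  by move=> ji; rewrite /gs /gauss_seidel !dfwithout // eq_sym.
have gs_i v : gs i v i = v by rewrite /gs /gauss_seidel dfwithin.
have res v : residual A b (gs i v) = A i *m v + rho.
  rewrite /residual (bigD1 i) //= gs_i /rho addrA; congr (_ + _ - _).
  by apply: eq_bigr => j ji; rewrite gs_ne.
have gs_fin v : theta i v \is a fin_num ->
    forall j, theta j (gs i v j) \is a fin_num.
  move=> fv j; have [->|ji] := eqVneq j i; first by rewrite gs_i.
  by rewrite gs_ne //; exact: gauss_seidel_fin_num.
have obj v : \sum_j fine (theta j (gs i v j)) =
    fine (theta i v) + \sum_(j | j != i) fine (theta j (gs i (x k.+1 i) j)).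
  rewrite (bigD1 i) //= gs_i; congr (_ + _).
  by apply: eq_bigr => j ji; rewrite gs_ne.
have -> : gs_dual beta (fun j => A j *m x k j) (fun j => A j *m x k.+1 j)
         (z k.+1) i = z k - beta *: (A i *m x k.+1 i + rho).
  have [_ zE] := admm k.
  rewrite /gs_dual zE -addrA; congr (_ + _).
  rewrite addrC -scalerBr -scalerN; congr (_ *: _).
  rewrite -res /residual !opprB addrC -addrA; congr (_ + _).
  rewrite -sumrN [X in _ + X]big_mkcond -big_split /= -sumrN; apply: eq_bigr => j _.
  rewrite /gs /gauss_seidel; case: (ltngtP i j) => [ij|ji|/val_inj <-].
  - rewrite dfwithout; last by rewrite -val_eqE /= neq_ltn ij.
    by rewrite ltnNge (ltnW ij) /= addKr.
  - rewrite dfwithout; last by rewrite -val_eqE /= neq_ltn ji orbT.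
    by rewrite ji addr0.
  - by rewrite dfwithin addr0.
apply: (prox_optimality (theta_gtNy (i := i)) si ci Xx fx) => // v Xv fv.
have [/(_ i) [_ _ xmin] _] := admm k.
have := xmin v Xv.
rewrite !aug_lagrangian_fine; [|exact: gs_fin|exact: gs_fin].
rewrite lee_fin -!/(gs i _) !res !obj; lra.
Qed.

End iterates.
End admm.

(** * Ergodic estimates *)

Lemma tau_ge0 (R : realType) (m : nat) (i : 'I_m) :
  (3 <= m)%N -> (1 < i)%N -> 0 <= tau R i.
Proof.
move=> m3 i1; rewrite /tau.
have h1 : 3 <= i.+1%:R :> R by rewrite ler_nat.
have h2 : 3 <= m%:R :> R by rewrite ler_nat.
have s0 : 0 <= Num.sqrt 33 :> R by exact: sqrtr_ge0.
have : 0 <= (7 + Num.sqrt 33) * (m%:R - 2) :> R by rewrite mulr_ge0 //; lra.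
lra.
Qed.

Lemma potential_ge (R : realType) (l m : nat) (beta : R)
    (al : 'I_m -> 'cV[R]_l) zz a a' z' (hm : (3 <= m)%N) (beta0 : 0 < beta) :
  [/\ forall i : 'I_m, (0 < i)%N ->
        beta / 2 * dotp (a' i - al i) (a' i - al i)
        <= potential beta al zz a a' z',
      (2 * beta)^-1 * dotp (z' - zz) (z' - zz) <= potential beta al zz a a' z'
    & 0 <= potential beta al zz a a' z'].
Proof.
rewrite /potential.
set S := \sum_(i < m | (0 < i)%N) _.
set T := beta * \sum_(i < m | (1 < i)%N) _; set Z := beta^-1 * _.
have T0 : 0 <= T.
  rewrite mulr_ge0 ?(ltW beta0) //; apply: sumr_ge0 => i i1.
  by rewrite mulr_ge0 ?tau_ge0 ?dotp_ge0.
have S0 : 0 <= S.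
  by rewrite /S; apply: sumr_ge0 => i _; rewrite mulr_ge0 ?(ltW beta0) ?dotp_ge0.
have Z0 : 0 <= Z by rewrite mulr_ge0 ?invr_ge0 ?(ltW beta0) ?dotp_ge0.
split; [move=> i i0| |by lra].
- have : beta * dotp (a' i - al i) (a' i - al i) <= S.
    rewrite /S (bigD1 i) //= lerDl sumr_ge0 // => j _.
    by rewrite mulr_ge0 ?(ltW beta0) ?dotp_ge0.
  lra.
- by rewrite invfM -mulrA -/Z; lra.
Qed.

(** Lets the potential, which controls squared norms, bound norms by constants
    free of square roots. *)
Lemma enorm_le1D (R : realType) (N : nat) (v : 'cV[R]_N) :
  enorm v <= 1 + dotp v v.
Proof.
by rewrite -enorm_sqr; have := sqr_ge0 (enorm v - 1); have := enorm_ge0 v; nra.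
Qed.

Section ergodic.
Context (R : realType) (m l : nat) (n : 'I_m -> nat).
Context (theta : forall i : 'I_m, 'cV[R]_(n i) -> \bar R).
Context (A : forall i : 'I_m, 'M[R]_(l, n i)).
Context (X : forall i : 'I_m, set 'cV[R]_(n i)).
Context (b : 'cV[R]_l) (mu : 'I_m -> R) (beta : R).
Context (x : nat -> blocks R n) (z : nat -> 'cV[R]_l).
Arguments theta : clear implicits.
Arguments X : clear implicits.
Context (hm : (3 <= m)%N).
Context (theta_gtNy : forall i y, (-oo < theta i y)%E).
Context (theta_convex : forall i, convex (theta i)).
Context (X_convex : forall i, @convex_set R 'cV[R]_(n i) (X i)).
Context (theta_strong : forall i : 'I_m, strongly_convex (mu i) (theta i)).
Context (beta0 : 0 < beta).
Context (block_modulus_le : forall (i : 'I_m) (v : 'cV[R]_(n i)),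
  block_modulus beta i * dotp (A i *m v) (A i *m v) <= mu i * dotp v v).
Context (admm : eADMM theta A X b beta x z).

Let a k i : 'cV[R]_l := A i *m x k i.
Let cost (u : blocks R n) : R := \sum_i fine (theta i (u i)).
Let Phi (w : point R l n) k : R :=
  potential beta (fun i => A i *m w.1 i) w.2 (a k) (a k.+1) (z k.+1).

(** F is affine with a skew-symmetric linear part, so only the two residuals
    survive. *)
Lemma point_dot_F (w' w : point R l n) :
  point_dot (point_sub w' w) (F A b w) =
  dotp w'.2 (residual A b w.1) - dotp w.2 (residual A b w'.1).
Proof.
rewrite /point_dot /=.
under eq_bigr do rewrite mulNmx dotpNr dotp_trmx mulmxBr dotpDl dotpNl.
have -> : \sum_(i < m) - (dotp (A i *m w'.1 i) w.2 - dotp (A i *m w.1 i) w.2)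
   = dotp w.2 (residual A b w.1) - dotp w.2 (residual A b w'.1).
  rewrite sumrN sumrB -!dotp_suml /residual !(dotpC _ w.2) !dotp_lin; ring.
by rewrite dotpDl dotpNl; ring.
Qed.

Lemma step_inequality k (w : point R l n) : W X w ->
  (forall i, theta i (w.1 i) \is a fin_num) ->
  cost (x k.+2) - cost w.1
  + point_dot (point_sub (x k.+2, z k.+2) w) (F A b w) <=
  beta * dotp (residual A b w.1) (\sum_(i < m | (0 < i)%N) (a k.+1 i - a k.+2 i))
  + (Phi w k - Phi w k.+1).
Proof.
move=> Xw fw; rewrite point_dot_F /= /cost -sumrB.
have opt j i (y : 'cV[R]_(n i)) (Xy : X i y) (fy : theta i y \is a fin_num) :
    block_modulus beta i / 2 * dotp (a j.+1 i - A i *m y) (a j.+1 i - A i *m y) <=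
    fine (theta i y) - fine (theta i (x j.+1 i))
    + dotp (a j.+1 i - A i *m y) (gs_dual beta (a j) (a j.+1) (z j.+1) i).
  have := block_optimality theta_gtNy admm j (@theta_strong i)
    (@X_convex i) Xy fy.
  have := @block_modulus_le i (x j.+1 i - y); rewrite mulmxBr -/(a j.+1 i).
  rewrite -/(a j) -/(a j.+1); lra.
have feas j i := iterate_feasible theta_gtNy admm j i.
apply: (descent_step hm beta0 (b := b) w.2).
- by have [_ ->] := admm k.+1.
- by move=> i; apply: opt.
- by move=> i; apply: opt => //; have [] := feas k i.
- by move=> i; apply: opt => //; have [] := feas k.+1 i.
Qed.

Lemma sum_step t (w : point R l n) : W X w ->
  (forall i, theta i (w.1 i) \is a fin_num) ->
  \sum_(1 <= k < t.+1) (cost (x k.+1) - cost w.1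
      + point_dot (point_sub (x k.+1, z k.+1) w) (F A b w)) <=
  beta * dotp (residual A b w.1) (\sum_(i < m | (0 < i)%N) (a 1 i - a t.+1 i))
  + (Phi w 0 - Phi w t).
Proof.
move=> Xw fw; rewrite big_add1 /=.
elim: t => [|t IH].
  rewrite big_nil subrr addr0 big1 ?dotp0 ?mulr0 // => i _; exact: subrr.
rewrite big_nat_recr //=; apply: (le_trans (lerD IH (step_inequality t Xw fw))).
rewrite [X in _ <= beta * X + _](_ : _ =
  dotp (residual A b w.1) (\sum_(i < m | (0 < i)%N) (a 1 i - a t.+1 i)) +
  dotp (residual A b w.1) (\sum_(i < m | (0 < i)%N) (a t.+1 i - a t.+2 i))).
  by move: (dotp _ _) (dotp _ _) => *; lra.
rewrite -dotpDr -big_split /=; congr dotp; apply: eq_bigr => i _.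
by rewrite addrA subrK.
Qed.

Lemma residual_avg t : (0 < t)%N ->
  residual A b (xavg x t) = t%:R^-1 *: \sum_(1 <= k < t.+1) residual A b (x k.+1).
Proof.
move=> t0; have tn0 : t%:R != 0 :> R by rewrite pnatr_eq0 -lt0n.
rewrite /residual sumrB scalerBr sumr_const_nat subSS subn0 -(scaler_nat t b).
rewrite scalerA mulVf // scale1r exchange_big /= scaler_sumr; congr (_ - _).
by apply: eq_bigr => i _; rewrite /xavg -scalemxAr mulmx_sumr.
Qed.

Lemma point_dot_avg t (w : point R l n) : (0 < t)%N ->
  point_dot (point_sub (wavg x z t) w) (F A b w) =
  t%:R^-1 * \sum_(1 <= k < t.+1) point_dot (point_sub (x k.+1, z k.+1) w) (F A b w).
Proof.
move=> t0; rewrite point_dot_F /= residual_avg // dotpZl dotpZr -mulrBr.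
rewrite dotp_suml dotp_sumr -sumrB; congr (_ * _).
by apply: eq_bigr => k _; rewrite point_dot_F.
Qed.

Lemma cost_avg t : (0 < t)%N ->
  [/\ forall i, X i (xavg x t i),
      forall i, theta i (xavg x t i) \is a fin_num &
      cost (xavg x t) <= t%:R^-1 * \sum_(1 <= k < t.+1) cost (x k.+1)].
Proof.
move=> t0; have avg i := average_in_convex (y := fun k => x k.+1 i)
  (theta_gtNy (i := i)) (@theta_convex i) (@X_convex i)
  (fun k _ => iterate_feasible theta_gtNy admm k i) t0.
split=> [i|i|]; [by case: (avg i)|by case: (avg i)|].
rewrite exchange_big /= mulr_sumr; apply: ler_sum => i _; by case: (avg i).
Qed.

(** Jensen's inequality averages the cost, the pairing with F(w) is affine in
    w_t, and the last potential is nonnegative. *)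
Lemma ergodic_bound t (w : point R l n) : (0 < t)%N -> W X w ->
  (forall i, theta i (w.1 i) \is a fin_num) ->
  cost (xavg x t) - cost w.1 + point_dot (point_sub (wavg x z t) w) (F A b w)
  <= t%:R^-1 * (beta * dotp (residual A b w.1)
                        (\sum_(i < m | (0 < i)%N) (a 1 i - a t.+1 i))
                + Phi w 0).
Proof.
move=> t0 Xw fw.
have tn0 : t%:R != 0 :> R by rewrite pnatr_eq0 -lt0n.
have it0 : 0 <= t%:R^-1 :> R by rewrite invr_ge0.
have [_ _ le_c] := cost_avg t0.
have [_ _ Phi0] := @potential_ge R l m beta (fun i => A i *m w.1 i) w.2 (a t)
  (a t.+1) (z t.+1) hm beta0.
rewrite point_dot_avg //.
have := ler_wpM2l it0 (sum_step t Xw fw).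
have := mulr_ge0 it0 Phi0; rewrite -/(Phi w t).
move: (Phi w 0) (Phi w t) => P0 Pt.
rewrite big_split sumrB sumr_const_nat subSS subn0 -(mulr_natl (cost w.1)) /=.
rewrite !mulrDr mulrN (mulrA t%:R^-1 t%:R) mulVf // mul1r; lra.
Qed.

(** The starting potential supplies the part of the bound that does not depend on
    kappa. *)
Lemma Phi0E (w : point R l n) :
  Phi w 0 = 2^-1 * vnormQ2 A beta (point_sub (x 1%N, z 1%N) w) + Cbar A beta x.
Proof.
rewrite /Phi /potential /vnormQ2 /Cbar /qnorm2 /=; congr (_ * (_ + _) + _ * _).
- apply: eq_bigr => i _.
  by rewrite -scalemxAl dotpZr -mulmxA dotp_trmx mulmxBr.
- by rewrite mul_scalar_mx dotpZr.
- by apply: eq_bigr => i _; rewrite enorm_sqr.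
Qed.

Lemma objective_avg_le kappa (w : point R l n) t : iterates_bounded A x z kappa ->
  W X w -> (1 <= t)%N ->
  (objective theta (xavg x t) - objective theta w.1
   + (point_dot (point_sub (wavg x z t) w) (F A b w))%:E
   <= (t%:R^-1 * (2 * beta * kappa * (m%:R - 1) * enorm (residual A b w.1)
                  + 2^-1 * vnormQ2 A beta (point_sub (x 1%N, z 1%N) w)
                  + Cbar A beta x))%:E)%E.
Proof.
move=> [a_le _] Xw t0; have [_ f_avg _] := cost_avg t0.
have [fw|/negP fw] := boolP (objective theta w.1 < +oo)%E; last first.
  rewrite objective_fine //; move/negP: fw.
  by rewrite -leNgt leye_eq => /eqP ->; rewrite /= addNye leNye.
have {}fw := objective_fin_num theta_gtNy fw.
rewrite !objective_fine // -EFinB -EFinD lee_fin.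
apply: (le_trans (ergodic_bound t0 Xw fw)).
rewrite ler_wpM2l ?invr_ge0 // Phi0E -addrA lerD2r.
have : dotp (residual A b w.1) (\sum_(i < m | (0 < i)%N) (a 1 i - a t.+1 i))
   <= enorm (residual A b w.1) * (2 * kappa * (m%:R - 1)).
  apply: (le_trans (cauchy_schwarz _ _)); rewrite ler_wpM2l ?enorm_ge0 //.
  apply: (le_trans (enorm_sum _ _ _)).
  apply: (@le_trans _ _ (\sum_(i < m | (0 < i)%N) (2 * kappa))).
    apply: ler_sum => i i0; apply: (le_trans (enormB _ _)).
    by rewrite mulr_natl mulr2n; apply: lerD; apply: a_le; rewrite ?orbT.
  rewrite (eq_bigl (fun i : 'I_m => (1 <= i < m)%N)) => [|i]; last first.
    by rewrite ltn_ord andbT.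
  rewrite sum_ord_range // -(mulr_natr _ (m - 1)) natrB //.
  by rewrite (leq_trans _ hm).
move=> /(ler_wpM2l (ltW beta0)); lra.
Qed.

Lemma residual_iterate k : residual A b (x k.+1) = beta^-1 *: (z k - z k.+1).
Proof.
have [_ ->] := admm k; rewrite opprB addrC subrK scalerA mulVf ?scale1r //.
by rewrite gt_eqF.
Qed.

Lemma residual_avg_le kappa t : iterates_bounded A x z kappa -> (1 <= t)%N ->
  enorm (residual A b (xavg x t)) <= 2 * kappa / beta / t%:R.
Proof.
move=> [_ z_le] t0; rewrite residual_avg //.
under eq_bigr do rewrite residual_iterate.
rewrite -scaler_sumr (telescope_sumr_eq (fun k => - z k)) //; last first.
  by move=> k _; rewrite opprK addrC.
rewrite opprK addrC scalerA enormZ ger0_norm; last first.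
  by rewrite mulr_ge0 ?invr_ge0 ?(ltW beta0).
rewrite [leRHS](_ : _ = t%:R^-1 * beta^-1 * (2 * kappa)); last by ring.
rewrite ler_wpM2l ?mulr_ge0 ?invr_ge0 ?(ltW beta0) //.
by rewrite mulr_natl mulr2n (le_trans (enormB _ _)) ?lerD.
Qed.

Context (solvable : solutions theta A X b !=set0).

(** The residual r of a saddle point vanishes, by comparing z* with z* - r. *)
Lemma saddle_pointP (ws : point R l n) : saddle_points theta A X b ws ->
  [/\ W X ws, forall i, theta i (ws.1 i) \is a fin_num,
      residual A b ws.1 = 0 &
      forall u, (forall i, X i (u i)) ->
        (forall i, theta i (u i) \is a fin_num) ->
        cost ws.1 <= cost u - dotp ws.2 (residual A b u)].
Proof.
move=> [Xws sad].
have [u0 [[Xu0 u0b] u0y _]] := solvable.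
have fs : forall i, theta i (ws.1 i) \is a fin_num.
  apply: (objective_fin_num theta_gtNy).
  have [_] := sad (u0, ws.2) Xu0.
  have fu0 := objective_fin_num theta_gtNy u0y.
  rewrite /lagrangian /= (objective_fine fu0).
  by case: (objective theta ws.1) => [r _||] //; rewrite ltry.
have res0 : residual A b ws.1 = 0.
  apply: enorm0_eq0; apply/eqP; rewrite -sqrf_eq0 enorm_sqr.
  rewrite eq_le dotp_ge0 andbT.
  have [+ _] := sad (ws.1, ws.2 - residual A b ws.1) Xws.
  rewrite /lagrangian /= (objective_fine fs) -!EFinB lee_fin.
  by rewrite dotpDl dotpNl; lra.
split=> // u Xu fu; have [_] := sad (u, ws.2) Xu.
rewrite /lagrangian /= (objective_fine fs) (objective_fine fu) -!EFinB lee_fin.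
by rewrite res0 dotp0 subr0.
Qed.

(** At a saddle point the left-hand side of [step_inequality] is nonnegative. *)
Lemma potential_decreasing (ws : point R l n) k :
  saddle_points theta A X b ws -> Phi ws k.+1 <= Phi ws k.
Proof.
move=> /saddle_pointP [Xws fs res0 sad].
have := step_inequality k Xws fs.
have feas i := iterate_feasible theta_gtNy admm k.+1 i.
have := sad (x k.+2) (fun i => proj1 (feas i)) (fun i => proj2 (feas i)).
rewrite point_dot_F /= res0 dotp0 dot0p mulr0 !add0r.
move: (Phi ws k) (Phi ws k.+1) => P Q; lra.
Qed.

Lemma potential_le_start (ws : point R l n) k :
  saddle_points theta A X b ws -> Phi ws k <= Phi ws 0.
Proof.
move=> sad; elim: k => // k; apply: le_trans; exact: potential_decreasing.
Qed.

(** The potential controls the multipliers and all images A_i x_i except the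
    first; the latter is b plus the residual, which is (z^k - z^{k+1}) / beta,
    minus the other images. *)
Lemma iterates_bounded_exists (ws : point R l n) :
  saddle_points theta A X b ws -> exists kappa, iterates_bounded A x z kappa.
Proof.
move=> sad; have le_start k := potential_le_start k sad.
have pot k := @potential_ge R l m beta (fun i => A i *m ws.1 i) ws.2 (a k)
  (a k.+1) (z k.+1) hm beta0.
pose rho := 1 + (beta / 2)^-1 * Phi ws 0.
pose zeta := 1 + 2 * beta * Phi ws 0.
have rho_le (i : 'I_m) k : (0 < i)%N -> enorm (a k.+1 i - A i *m ws.1 i) <= rho.
  move=> i0; apply: (le_trans (enorm_le1D _)); rewrite lerD2l.
  rewrite ler_pdivlMl ?divr_gt0 //; apply: le_trans (le_start k).
  by have [+ _ _] := pot k; apply.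
have zeta_le k : enorm (z k.+1 - ws.2) <= zeta.
  apply: (le_trans (enorm_le1D _)); rewrite lerD2l.
  rewrite -ler_pdivrMl ?mulr_gt0 //; apply: le_trans (le_start k).
  by have [_ + _] := pot k.
have Phi0 : 0 <= Phi ws 0 by have [] := pot 0%N.
have rho0 : 0 <= rho by rewrite addr_ge0 // mulr_ge0 // invr_ge0 divr_ge0 // ltW.
have zeta0 : 0 <= zeta by rewrite addr_ge0 // !mulr_ge0 // ltW.
clearbody rho zeta.
pose Kz := enorm (z 0) + (zeta + enorm ws.2).
pose Ka i := enorm (a 0 i) + (rho + enorm (A i *m ws.1 i)).
pose K0 := enorm b + (beta^-1 * (Kz + Kz) + \sum_(i < m | (0 < i)%N) Ka i).
have Kz0 : 0 <= Kz by rewrite !addr_ge0 ?enorm_ge0.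
have Ka0 i : 0 <= Ka i by rewrite !addr_ge0 ?enorm_ge0.
have bK0 : 0 <= beta^-1 * (Kz + Kz).
  by apply: mulr_ge0; [rewrite invr_ge0 ltW|exact: addr_ge0].
have K00 : 0 <= K0 by rewrite !addr_ge0 ?enorm_ge0 ?sumr_ge0.
have z_le k : enorm (z k) <= Kz.
  case: k => [|k]; first by rewrite lerDl addr_ge0 ?enorm_ge0.
  rewrite -[z k.+1](subrK ws.2) (le_trans (enormD _ _)) //.
  by rewrite ler_wpDl ?enorm_ge0 ?lerD2r.
have a_le (i : 'I_m) k : (0 < i)%N -> enorm (a k i) <= Ka i.
  move=> i0; case: k => [|k]; first by rewrite lerDl addr_ge0 ?enorm_ge0.
  rewrite -[a k.+1 i](subrK (A i *m ws.1 i)) (le_trans (enormD _ _)) //.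
  by rewrite ler_wpDl ?enorm_ge0 ?lerD2r ?rho_le.
exists (Kz + K0); split; last first.
  by move=> k; rewrite (le_trans (z_le k)) // lerDl.
move=> i k; have [i0 _|] := ltnP 0 i.
  rewrite (le_trans (a_le i k i0)) // (@le_trans _ _ K0) ?lerDr //.
  by rewrite /K0 addrA (bigD1 i) //= addrCA lerDl !addr_ge0 ?sumr_ge0 ?enorm_ge0.
rewrite leqn0 => /eqP i0 /=; case: k => // k _.
have -> : A i *m x k.+1 i = b + (beta^-1 *: (z k - z k.+1)
     - \sum_(j < m | (0 < j)%N) a k.+1 j).
  rewrite -residual_iterate /residual (bigD1 i) //=.
  rewrite (eq_bigl (fun j : 'I_m => (0 < j)%N)) => [|j]; last first.
    by rewrite -val_eqE /= i0 lt0n.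
  by rewrite addrAC addrK [RHS]addrC subrK.
rewrite (@le_trans _ _ K0) ?lerDr //.
rewrite (le_trans (enormD _ _)) // lerD2l (le_trans (enormB _ _)) // lerD //.
  rewrite enormZ ger0_norm ?invr_ge0 ?(ltW beta0) //.
  rewrite ler_wpM2l ?invr_ge0 ?(ltW beta0) //.
  by rewrite (le_trans (enormB _ _)) ?lerD.
rewrite (le_trans (enorm_sum _ _ _)) //; apply: ler_sum => j; exact: a_le.
Qed.

(** The constant serves all saddle points at once, because they share the same
    cost; it is computed from one of them.  The upper bound is
    [ergodic_bound] at (u*, 0), where the pairing with F vanishes. *)
Lemma cost_gap (ws0 : point R l n) kappa : saddle_points theta A X b ws0 ->
  iterates_bounded A x z kappa ->
  exists2 c2 : R, 0 < c2 &
        forall ws : point R l n, saddle_points theta A X b ws ->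
        forall t : nat, (1 <= t)%N ->
          (`|objective theta (xavg x t) - objective theta ws.1|
           <= (c2 / t%:R)%:E)%E.
Proof.
move=> sad0 bnd; have [Xs0 fs0 res0 min0] := saddle_pointP sad0.
pose w0 : point R l n := (ws0.1, 0).
have Phi0 : 0 <= Phi w0 0.
  by have [] := @potential_ge R l m beta (fun i => A i *m w0.1 i) w0.2 (a 0)
    (a 1) (z 1) hm beta0.
have kappa0 : 0 <= kappa by have [_ /(_ 0%N)] := bnd; exact: le_trans (enorm_ge0 _).
have gap0 : 0 <= enorm ws0.2 * (2 * kappa / beta).
  by rewrite mulr_ge0 ?enorm_ge0 // divr_ge0 ?(ltW beta0) // mulr_ge0.
exists (1 + (Phi w0 0 + enorm ws0.2 * (2 * kappa / beta))).
  by rewrite ltr_pwDl // addr_ge0.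
move=> ws sad t t0; have [Xs fs res min] := saddle_pointP sad.
have [X_avg f_avg _] := cost_avg t0.
rewrite !objective_fine // -EFinB abse_EFin lee_fin -/(cost _) -/(cost ws.1).
have -> : cost ws.1 = cost ws0.1.
  have := min ws0.1 Xs0 fs0; have := min0 ws.1 Xs fs.
  by rewrite res res0 !dotp0 !subr0 => h1 h2; apply/le_anti/andP.
have tV0 : 0 < t%:R^-1 :> R by rewrite invr_gt0 ltr0n.
have up := ergodic_bound t0 (w := w0) Xs0 fs0.
rewrite point_dot_F /= res0 dotp0 !dot0p mulr0 !add0r oppr0 addr0 in up.
have := min0 _ X_avg f_avg.
have := cauchy_schwarz (- ws0.2) (residual A b (xavg x t)).
rewrite enormN dotpNl => cs.
have := ler_wpM2l (enorm_ge0 ws0.2) (residual_avg_le bnd t0).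
have := mulr_ge0 (ltW tV0) Phi0; have := mulr_ge0 (ltW tV0) gap0.
move: up; move: (Phi w0 0) => P up h1 h2 h3 h4.
rewrite ler_norml; apply/andP; split; lra.
Qed.

End ergodic.

(** * Convergence of the method *)

Lemma block_modulus_le (R : realType) (m l N : nat) (M : 'M[R]_(l, N))
    (i : 'I_m) (mu beta : R) (v : 'cV[R]_N) : (3 <= m)%N -> (1 < i)%N ->
  0 < beta -> 0 < mu ->
  beta < mu / (stepsize_coef R m * spectral_norm (M^T *m M)) ->
  block_modulus beta i * dotp (M *m v) (M *m v) <= mu * dotp v v.
Proof.
move=> hm i1 beta0 mu0 beta_lt; rewrite /block_modulus i1 mulr1n.
have c0 := stepsize_coef_gt0 R hm.
(* If the norm were 0, the step size bound would be mu / 0 = 0. *)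
have N0 : 0 < spectral_norm (M^T *m M).
  rewrite lt0r spectral_norm_ge0 andbT; apply/eqP => N0.
  by move: beta_lt; rewrite N0 mulr0 invr0 mulr0 ltNge ltW.
rewrite ltr_pdivlMr ?mulr_gt0 // in beta_lt.
apply: (@le_trans _ _ (stepsize_coef R m * beta
                       * (spectral_norm (M^T *m M) * dotp v v))).
  by rewrite ler_wpM2l ?dotp_mulmx_le // mulr_ge0 ?ltW.
by rewrite mulrA ler_wpM2r ?dotp_ge0 // (mulrC _ beta) -mulrA ltW.
Qed.

Theorem theorem4p1 (R : realType) (m l : nat) (n : 'I_m -> nat)
    (theta : forall i : 'I_m, 'cV[R]_(n i) -> \bar R)
    (A : forall i : 'I_m, 'M[R]_(l, n i))
    (X : forall i : 'I_m, set 'cV[R]_(n i))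
    (b : 'cV[R]_l) (mu : 'I_m -> R) (beta : R)
    (x : nat -> blocks R n) (z : nat -> 'cV[R]_l)
    (hm : (3 <= m)%N)
    (htheta : forall i : 'I_m, closed_proper_convex (theta i))
    (hX : forall i : 'I_m,
       [/\ X i !=set0, closed (X i) & @convex_set R 'cV[R]_(n i) (X i)])
    (hsol : solutions theta A X b !=set0)
    (hsaddle : saddle_points theta A X b !=set0)
    (hstrong : forall i : 'I_m, (3 <= i.+1)%N ->
       0 < mu i /\ strongly_convex (mu i) (theta i))
    (hrank : forall i : 'I_m, \rank (A i) = n i)
    (hslater : exists u' : blocks R n,
       feasible A X b u' /\ ri (dom_prod theta) (\mxcol_(i < m) u' i))
    (hbeta0 : 0 < beta)
    (hbeta : forall i : 'I_m, (3 <= i.+1)%N ->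
       beta < mu i / (((13 + Num.sqrt 33) / 4 * m%:R - (17 + Num.sqrt 33) / 2)
                      * spectral_norm ((A i)^T *m A i)))
    (hadmm : eADMM theta A X b beta x z) :
  [/\ exists kappa : R, iterates_bounded A x z kappa,
      forall kappa : R, iterates_bounded A x z kappa ->
      forall w : point R l n, W X w ->
      forall t : nat, (1 <= t)%N ->
        (objective theta (xavg x t) - objective theta w.1
         + (point_dot (point_sub (wavg x z t) w) (F A b w))%:E
         <= (t%:R^-1 * (2 * beta * kappa * (m%:R - 1) * enorm (residual A b w.1)
                        + 2^-1 * vnormQ2 A beta (point_sub (x 1%N, z 1%N) w)
                        + Cbar A beta x))%:E)%E,
      exists2 c1 : R, 0 < c1 &
        forall t : nat, (1 <= t)%N ->
          enorm (residual A b (xavg x t)) ^+ 2 <= c1 / t%:R ^+ 2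
    & exists2 c2 : R, 0 < c2 &
        forall ws : point R l n, saddle_points theta A X b ws ->
        forall t : nat, (1 <= t)%N ->
          (`|objective theta (xavg x t) - objective theta ws.1|
           <= (c2 / t%:R)%:E)%E].
Proof.
have theta_gtNy i y : (-oo < theta i y)%E by have [_ [_]] := htheta i.
have theta_convex i : convex (theta i) by have [] := htheta i.
have X_convex i : @convex_set R 'cV[R]_(n i) (X i) by have [] := hX i.
(* The first two blocks are merely convex: modulus 0. *)
pose mu0 (i : 'I_m) := if (1 < i)%N then mu i else 0.
have strong (i : 'I_m) : strongly_convex (mu0 i) (theta i).
  rewrite /mu0; case: ifP => [i1|_]; first by have [] := hstrong i i1.
  exact: convex_strongly_convex0.
have modulus_le (i : 'I_m) (v : 'cV[R]_(n i)) :
    block_modulus beta i * dotp (A i *m v) (A i *m v) <= mu0 i * dotp v v.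
  rewrite /mu0; case: ifP => [i1|i1]; last first.
    by rewrite /block_modulus i1 mulr0n !mul0r.
  by apply: block_modulus_le => //; [have [] := hstrong i i1|exact: hbeta].
have [ws0 sad0] := hsaddle.
have [kappa bnd] : exists kappa, iterates_bounded A x z kappa.
  exact: (iterates_bounded_exists hm theta_gtNy X_convex strong hbeta0 _ _ _ sad0).
split.
- by exists kappa.
- move=> kap bk w Xw t t1.
  exact: (objective_avg_le hm theta_gtNy theta_convex X_convex strong).
(* The summand 1 makes the constant positive even if kappa = 0. *)
- exists ((2 * kappa / beta) ^+ 2 + 1) => [|t t1].
    by rewrite ltr_wpDl // sqr_ge0.
  have res_le := residual_avg_le hbeta0 hadmm bnd t1.
  rewrite (@le_trans _ _ ((2 * kappa / beta / t%:R) ^+ 2)) //.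
    by rewrite ler_sqr ?nnegrE ?enorm_ge0 // (le_trans (enorm_ge0 _) res_le).
  by rewrite expr_div_n ler_wpM2r ?invr_ge0 ?exprn_ge0 // lerDl.
- exact: (cost_gap hm theta_gtNy theta_convex X_convex strong hbeta0 _ _ _
    sad0 bnd).
Qed.
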